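(* Let $\mathbb{F}$ be an algebraically closed field of characteristic $p\neq 2$. The trace of any word in matrices $A_1,\ldots,A_n\in \mathrm{SL}_2(\mathbb{F})$ and their inverses is a polynomial in the $d=n+\binom{n}{2}+\binom{n}{3}$ traces $$\mathrm{tr}(A_{j_1}\cdots A_{j_m}),\qquad 1\le j_1<j_2<\cdots<j_m\le n,\quad m\le 3 .$$
   Context: The characteristic $p$ is allowed to be $0$. The polynomial depends only on the word, not on the particular matrices: for each word $W$ in $n$ letters and their inverses there is a polynomial in $d$ variables with coefficients in $\mathbb{F}$ which evaluates to $\mathrm{tr}(W(A_1,\ldots,A_n))$ on the listed traces, for all $(A_1,\ldots,A_n)\in \mathrm{SL}_2(\mathbb{F})^n$. *)

(* Defs.v *)
From HB Require Import structures.
From mathcomp Require Import all_boot all_order all_algebra.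
From mathcomp Require Import mpoly.

Set Implicit Arguments.
Unset Strict Implicit.
Unset Printing Implicit Defensive.

Import GRing.Theory.
Local Open Scope ring_scope.

(* A word in n letters and their inverses: (i, false) stands for the i-th
   letter and (i, true) for its inverse.  Words need not be reduced. *)
Definition word (n : nat) := seq ('I_n * bool).

Definition word_eval (F : fieldType) (n : nat) (A : 'I_n -> 'M[F]_2)
    (w : word n) : 'M[F]_2 :=
  \prod_(l <- w) (if l.2 then invmx (A l.1) else A l.1).

(* The sequences j_1 < ... < j_m of indices. *)
Definition increasing_seqs (n m : nat) : seq (seq 'I_n) :=
  [seq tval t | t in [set t : m.-tuple 'I_n | sorted ltn (map val t)]].

Definition num_traces (n : nat) : nat := (n + 'C(n, 2) + 'C(n, 3))%N.

Definition trace_index_seq (n : nat) : seq (seq 'I_n) :=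
  increasing_seqs n 1 ++ increasing_seqs n 2 ++ increasing_seqs n 3.

Lemma size_increasing_seqs n m : size (increasing_seqs n m) = 'C(n, m).
Proof. by rewrite size_map -cardE card_ltn_sorted_tuples. Qed.

Lemma size_trace_index_seq n : size (trace_index_seq n) == num_traces n.
Proof. by rewrite !size_cat !size_increasing_seqs bin1 addnA. Qed.

Definition trace_indices (n : nat) : (num_traces n).-tuple (seq 'I_n) :=
  Tuple (size_trace_index_seq n).

Lemma mem_increasing_seqs n m (s : seq 'I_n) :
  (s \in increasing_seqs n m) = (size s == m) && sorted ltn (map val s).
Proof.
apply/imageP/andP => [[t + ->]|[sm ss]]; first by rewrite inE size_tuple.
by exists (Tuple sm); rewrite ?inE.
Qed.

Lemma mem_trace_indices n (s : seq 'I_n) :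
  (s \in trace_indices n) = (0 < size s <= 3)%N && sorted ltn (map val s).
Proof.
rewrite !mem_cat !mem_increasing_seqs -!andb_orl; congr (_ && _).
by case: (size s) => [|[|[|[|k]]]].
Qed.

Lemma uniq_trace_indices n : uniq (trace_indices n).
Proof.
have Ui m : uniq (increasing_seqs n m).
  by rewrite map_inj_uniq ?enum_uniq //; apply: val_inj.
rewrite !cat_uniq !Ui /= !andbT; apply/andP; split; apply/hasPn => s.
  by rewrite mem_cat !mem_increasing_seqs => /orP[]/andP[/eqP-> _].
by rewrite !mem_increasing_seqs => /andP[/eqP-> _].
Qed.

(* The values tr(A_{j_1} ... A_{j_m}) substituted for the variables. *)
Definition trace_vals (F : fieldType) (n : nat) (A : 'I_n -> 'M[F]_2)
    (k : 'I_(num_traces n)) : F :=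
  \tr (\prod_(j <- tnth (trace_indices n) k) A j).

(* Main.v *)
Require Import Defs.
From HB Require Import structures.
From mathcomp Require Import all_boot all_order all_algebra.
From mathcomp Require Import mpoly.
From mathcomp Require Import ring.

Set Implicit Arguments.
Unset Strict Implicit.
Unset Printing Implicit Defensive.

Import GRing.Theory.
Local Open Scope ring_scope.

(** Every word reduces to a combination of words of length at most 2 whose
    coefficients are polynomials in the traces.  Indeed, the Cayley-Hamilton
    theorem yields an identity ([mul3_mx2]) that writes [2 ABC] as a combination
    of [1], the letters [A], [B], [C], and the products [AB], [AC], [BC], the
    coefficients being integer polynomials in traces of products of at most three
    letters.  Since 2 is invertible, the span of [1], [A i] and [A i * A j] over
    the polynomials in the traces is stable under left multiplication by each
    [A k] ([trace_span_mul]), hence also by its inverse, which is [tr A - A] when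
    [det A = 1].  So this span contains every word ([trace_span_word]), and the
    trace of a word is a polynomial in traces of words of at most three letters.

    Those traces may have repeated or unordered indices.  Cyclicity of the
    trace, the relation [A^2 = (tr A) A - 1], and the fact that
    [tr (ABC) + tr (BAC)] is a polynomial in traces of at most two letters
    ([mxtrace_mul3_swap]) bring them back to strictly increasing indices
    ([trace_poly3]). *)

(** * Identities for two by two matrices *)

Section Matrix2.

Variable R : comNzRingType.
Implicit Types A B C : 'M[R]_2.

Lemma eq_mx2 A B :
    A 0 0 = B 0 0 -> A 0 1 = B 0 1 -> A 1 0 = B 1 0 -> A 1 1 = B 1 1 ->
  A = B.
Proof.
move=> e00 e01 e10 e11; apply/matrixP=> i j.
have ord2 (k : 'I_2) : k = 0 \/ k = 1.
  by case: k => [[|[|//]] ?]; [left | right]; apply: val_inj.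
by case: (ord2 i) => ->; case: (ord2 j) => ->.
Qed.

Lemma mul_mx2E A B i j : (A * B) i j = A i 0 * B 0 j + A i 1 * B 1 j.
Proof.
rewrite -mulmxE mxE !big_ord_recl big_ord0 addr0.
by congr (_ + A i _ * B _ j); apply: val_inj.
Qed.

Lemma mxtrace2E A : \tr A = A 0 0 + A 1 1.
Proof.
rewrite /mxtrace !big_ord_recl big_ord0 addr0.
by congr (_ + A _ _); apply: val_inj.
Qed.

Lemma one_mx2E :
  ((1 : 'M[R]_2) 0 0 = 1) * ((1 : 'M[R]_2) 0 1 = 0) *
  ((1 : 'M[R]_2) 1 0 = 0) * ((1 : 'M[R]_2) 1 1 = 1).
Proof. by rewrite !mxE. Qed.

Lemma det_mx2E A : \det A = A 0 0 * A 1 1 - A 0 1 * A 1 0.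
Proof.
rewrite (expand_det_row _ 0) !big_ord_recl big_ord0 /cofactor !det_mx11 !mxE /=.
have l00 : lift 0 0 = 1 :> 'I_2 by apply: val_inj.
have l10 : lift 1 0 = 0 :> 'I_2 by apply: val_inj.
by rewrite !l00 l10 /=; ring.
Qed.

Definition mx2E := (mxtrace2E, mul_mx2E, one_mx2E).

Lemma sqr_mx2 A : A * A = \tr A *: A - \det A *: 1.
Proof. by apply: eq_mx2; rewrite det_mx2E !(mx2E, mxE); ring. Qed.

(** For traceless [a], [b], [c] Cayley-Hamilton gives [ab + ba = tr(ab)], and
    likewise for the other pairs, so moving letters past each other yields
    [abc + cba = tr(bc) a - tr(ac) b + tr(ab) c].  The adjugate of [abc] is
    [- cba], so that [abc - cba = tr(abc)].  Adding the two computes [2 abc];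
    the general identity comes from [a = A - tr(A)/2] and its analogues, and
    its coefficients turn out to be integers. *)
Lemma mul3_mx2 A B C :
  A * (B * C) *+ 2 =
    (\tr (A * (B * C)) - \tr A * \tr (B * C) - \tr C * \tr (A * B)
       + \tr A * \tr B * \tr C) *: 1
    + (\tr (B * C) - \tr B * \tr C) *: A - \tr (A * C) *: B
    + (\tr (A * B) - \tr A * \tr B) *: C
    + \tr A *: (B * C) + \tr B *: (A * C) + \tr C *: (A * B).
Proof. by apply: eq_mx2; rewrite mulr2n !(mx2E, mxE); ring. Qed.

(** Polarizing [A^2 - (tr A) A + det A = 0] expresses [AB + BA] through [A], [B]
    and [1]; multiply by [C] and take traces. *)
Lemma mxtrace_mul3_swap A B C :
  \tr (B * (A * C)) =
    \tr A * \tr (B * C) + \tr B * \tr (A * C) + \tr C * \tr (A * B)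
    - \tr A * \tr B * \tr C - \tr (A * (B * C)).
Proof. by rewrite !mx2E; ring. Qed.

End Matrix2.

Lemma invmx_sl2 (R : comUnitRingType) (A : 'M[R]_2) :
  \det A = 1 -> invmx A = \tr A *: 1 - A.
Proof.
move=> detA; have Au : A \in unitmx by rewrite unitmxE detA unitr1.
rewrite -[RHS](mulKmx Au) mulmxE mulrBr sqr_mx2 detA scale1r -scalerAr mulr1.
by rewrite subKr -mulmxE mulmx1.
Qed.

(** * Polynomials in the traces *)

Section TracePolynomials.

Variables (F : fieldType) (n : nat).
Implicit Types (A : 'I_n -> 'M[F]_2) (f g : ('I_n -> 'M[F]_2) -> F).
Implicit Types (X Y : ('I_n -> 'M[F]_2) -> 'M[F]_2) (i j k : 'I_n).

Definition all_sl2 A := forall i, \det (A i) = 1.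

Definition trace_poly f :=
  exists P : {mpoly F[num_traces n]},
    forall A, all_sl2 A -> f A = P.@[trace_vals A].

Lemma eq_trace_poly f g :
  (forall A, all_sl2 A -> g A = f A) -> trace_poly f -> trace_poly g.
Proof. by move=> fg [P fP]; exists P => A A1; rewrite fg ?fP. Qed.

Lemma trace_polyC c : trace_poly (fun=> c).
Proof. by exists c%:MP => A _; rewrite mevalC. Qed.

Lemma trace_polyD f g :
  trace_poly f -> trace_poly g -> trace_poly (fun A => f A + g A).
Proof.
by move=> [P fP] [Q gQ]; exists (P + Q) => A A1; rewrite mevalD fP ?gQ.
Qed.

Lemma trace_polyM f g :
  trace_poly f -> trace_poly g -> trace_poly (fun A => f A * g A).
Proof.
by move=> [P fP] [Q gQ]; exists (P * Q) => A A1; rewrite mevalM fP ?gQ.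
Qed.

Lemma trace_polyN f : trace_poly f -> trace_poly (fun A => - f A).
Proof. by move=> [P fP]; exists (- P) => A A1; rewrite mevalN fP. Qed.

Lemma trace_poly_increasing (s : seq 'I_n) :
    (0 < size s <= 3)%N -> sorted ltn (map val s) ->
  trace_poly (fun A => \tr (\prod_(j <- s) A j)).
Proof.
move=> s3 s_inc; have: s \in trace_indices n by rewrite mem_trace_indices s3.
by case/tnthP=> k ->; exists 'X_k => A _; rewrite mevalXU.
Qed.

Lemma trace_poly1 i : trace_poly (fun A => \tr (A i)).
Proof.
apply: eq_trace_poly (trace_poly_increasing (s := [:: i]) isT isT) => A _.
by rewrite big_seq1.
Qed.

Lemma trace_poly2 i j : trace_poly (fun A => \tr (A i * A j)).
Proof.
wlog le_ij : i j / (i <= j)%N.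
  move=> IH; case: (leqP i j) => [/IH //|/ltnW/IH].
  by apply: eq_trace_poly => A _; rewrite -!mulmxE mxtrace_mulC.
move: le_ij; rewrite leq_eqVlt => /orP[/eqP/val_inj<-|lt_ij].
  (* The constant is [tr 1 = 2], from [A^2 = (tr A) A - 1]. *)
  apply: (@eq_trace_poly (fun A => \tr (A i) * \tr (A i) + - 2)).
    by move=> A A1; rewrite sqr_mx2 A1 scale1r raddfB /= mxtraceZ mxtrace1.
  apply: trace_polyD (trace_polyC _).
  exact: trace_polyM (trace_poly1 i) (trace_poly1 i).
apply: eq_trace_poly (trace_poly_increasing (s := [:: i; j]) isT _) => [A _|].
  by rewrite big_cons big_seq1.
by rewrite /= lt_ij.
Qed.

Lemma trace_poly3_rot i j k :
  trace_poly (fun A => \tr (A i * (A j * A k))) ->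
  trace_poly (fun A => \tr (A j * (A k * A i))).
Proof.
by apply: eq_trace_poly => A _; rewrite mulrA -!mulmxE mxtrace_mulC.
Qed.

Lemma trace_poly3_swap i j k :
  trace_poly (fun A => \tr (A i * (A j * A k))) ->
  trace_poly (fun A => \tr (A j * (A i * A k))).
Proof.
move=> Tijk; apply: (eq_trace_poly (fun A _ => mxtrace_mul3_swap _ _ _)).
do ?apply: trace_polyD; do ?apply: trace_polyN; do ?apply: trace_polyM;
  by [apply: trace_poly1 | apply: trace_poly2 | exact: Tijk].
Qed.

(** Swaps and rotations generate all permutations of the three indices, so that
    it suffices to treat increasing triples and those that start with a repeated
    index, where [A^2 = (tr A) A - 1] shortens the word. *)
Lemma trace_poly3 i j k : trace_poly (fun A => \tr (A i * (A j * A k))).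
Proof.
have Teq a c : trace_poly (fun A => \tr (A a * (A a * A c))).
  apply: (@eq_trace_poly
            (fun A => \tr (A a) * \tr (A a * A c) + - \tr (A c))).
    move=> A A1; rewrite mulrA sqr_mx2 A1 scale1r mulrBl mul1r -scalerAl.
    by rewrite raddfB /= mxtraceZ.
  apply: trace_polyD; last exact: trace_polyN (trace_poly1 c).
  exact: trace_polyM (trace_poly1 a) (trace_poly2 a c).
have Tinc (a b c : 'I_n) :
    (a < b < c)%N -> trace_poly (fun A => \tr (A a * (A b * A c))).
  move=> /andP[ab bc].
  apply: eq_trace_poly (trace_poly_increasing (s := [:: a; b; c]) isT _).
    by move=> A _; rewrite !big_cons big_nil mulr1.
  by rewrite /= ab bc.
wlog le_ij : i j / (i <= j)%N.
  move=> IH; case: (leqP i j) => [/IH //|/ltnW/IH].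
  exact: trace_poly3_swap.
move: le_ij; rewrite leq_eqVlt => /orP[/eqP/val_inj<-|lt_ij]; first exact: Teq.
case: (ltngtP j k) => [lt_jk|lt_kj|/val_inj<-].
- by apply: Tinc; rewrite lt_ij.
- case: (ltngtP i k) => [lt_ik|lt_ki|/val_inj<-].
  + apply: trace_poly3_swap; apply/trace_poly3_rot/trace_poly3_rot/Tinc.
    by rewrite lt_ik.
  + by apply/trace_poly3_rot/Tinc; rewrite lt_ki.
  + by apply/trace_poly3_rot/Teq.
- by apply/trace_poly3_rot/trace_poly3_rot/Teq.
Qed.

(** * Reduction of words to length at most two *)

(** This is the module spanned by the words of length at most 2 over the
    polynomials in the traces.  Its elements are functions of the tuple [A], and a
    member may be replaced by any function that agrees with it when all
    determinants are 1. *)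
Inductive trace_span : (('I_n -> 'M[F]_2) -> 'M[F]_2) -> Prop :=
| TraceSpan1 : trace_span (fun=> 1)
| TraceSpanLetter i : trace_span (fun A => A i)
| TraceSpanPair i j : trace_span (fun A => A i * A j)
| TraceSpanD X Y :
    trace_span X -> trace_span Y -> trace_span (fun A => X A + Y A)
| TraceSpanZ f X :
    trace_poly f -> trace_span X -> trace_span (fun A => f A *: X A)
| TraceSpanEq X Y :
    (forall A, all_sl2 A -> Y A = X A) -> trace_span X -> trace_span Y.

Lemma trace_spanN X : trace_span X -> trace_span (fun A => - X A).
Proof.
move=> sX; apply: TraceSpanEq (TraceSpanZ (trace_polyC (- 1)) sX) => A _.
by rewrite scaleN1r.
Qed.

Lemma trace_span_triple i j k :
  2 != 0 :> F -> trace_span (fun A => A i * (A j * A k)).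
Proof.
move=> nz2; apply: (@TraceSpanEq (fun A => 2^-1 *: (A i * (A j * A k) *+ 2))).
  by move=> A _; rewrite -scaler_nat scalerA mulVf ?scale1r.
apply: (TraceSpanZ (trace_polyC _)).
apply: (TraceSpanEq (fun A _ => mul3_mx2 _ _ _)).
do !apply: TraceSpanD; do ?apply: trace_spanN; apply: TraceSpanZ;
  do ?[exact: TraceSpan1 | exact: TraceSpanLetter | exact: TraceSpanPair];
  do ?apply: trace_polyD; do ?apply: trace_polyN; do ?apply: trace_polyM;
  by [apply: trace_poly1 | apply: trace_poly2 | apply: trace_poly3].
Qed.

Lemma trace_span_mul k X :
  2 != 0 :> F -> trace_span X -> trace_span (fun A => A k * X A).
Proof.
move=> nz2; elim=> {X} [|i|i j|X Y _ sX _ sY|f X pf _ sX|X Y XY _ sX].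
- by apply: TraceSpanEq (TraceSpanLetter k) => A _; rewrite mulr1.
- exact: TraceSpanPair.
- exact: trace_span_triple.
- by apply: TraceSpanEq (TraceSpanD sX sY) => A _; rewrite mulrDr.
- by apply: TraceSpanEq (TraceSpanZ pf sX) => A _; rewrite -scalerAr.
- by apply: TraceSpanEq sX => A A1; rewrite XY.
Qed.

Lemma trace_span_word (w : word n) :
  2 != 0 :> F -> trace_span (fun A => word_eval A w).
Proof.
move=> nz2; elim: w => [|[i b] w sw].
  by apply: TraceSpanEq TraceSpan1 => A _; rewrite /word_eval big_nil.
have sAw := trace_span_mul i nz2 sw.
case: b.
  apply: TraceSpanEq (TraceSpanD (TraceSpanZ (trace_poly1 i) sw)
                                 (trace_spanN sAw)) => A A1.
  by rewrite /word_eval big_cons /= invmx_sl2 // mulrBl -scalerAl mul1r.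
by apply: TraceSpanEq sAw => A _; rewrite /word_eval big_cons.
Qed.

(** Taking the trace of the generators leaves only traces of words of length at
    most 2; traces of triples enter through the coefficients. *)
Lemma trace_poly_span X : trace_span X -> trace_poly (fun A => \tr (X A)).
Proof.
elim=> {X} [|i|i j|X Y _ pX _ pY|f X pf _ pX|X Y XY _ pX].
- exact: trace_polyC.
- exact: trace_poly1.
- exact: trace_poly2.
- by apply: eq_trace_poly (trace_polyD pX pY) => A _; rewrite mxtraceD.
- by apply: eq_trace_poly (trace_polyM pf pX) => A _; rewrite mxtraceZ.
- by apply: eq_trace_poly pX => A A1; rewrite XY.
Qed.

End TracePolynomials.

Theorem corollary5 (F : closedFieldType) (char_neq2 : 2%N \notin [pchar F])
    (n : nat) (w : word n) :
  exists P : {mpoly F[n + 'C(n, 2) + 'C(n, 3)]},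
    forall A : 'I_n -> 'M[F]_2, (forall i, \det (A i) = 1) ->
      \tr (word_eval A w) = P.@[trace_vals A].
Proof.
have nz2 : 2 != 0 :> F by move: char_neq2; rewrite inE.
exact: trace_poly_span (trace_span_word w nz2).
Qed.
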